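(* Let $\Gamma$ be a finite connected multigraph without self-loops and with at least two vertices, with a chosen sink $v_*$. Assume there is a vertex $v\neq v_*$ of $\Gamma$ that is adjacent to $v_*$ and satisfies the following: (a) if $w\ne v$ is a vertex, then $w$ can be connected to $v_*$ by an edge-path that does not contain $v$; (b) $v$ has degree $d(v)\ge 2$. Then there is a sandpile on $\Gamma$ that is mutable.
   Context: $\Gamma$ has vertex set $\mathcal{V}$, and $\mathcal{V}'=\mathcal{V}\setminus\{v_*\}$. For $v\in\mathcal{V}$, $d(v)$ is the degree of $v$ in $\Gamma$ (number of edges at $v$, including edges to the sink). The Laplacian $L$ is the $\mathcal{V}\times\mathcal{V}$ matrix with $L_{vv}=d(v)$ and $L_{vw}=-\#(v,w)$ for $v\ne w$, where $\#(v,w)$ is the number of edges joining $v$ and $w$. The reduced Laplacian $L'$ is the $\mathcal{V}'\times\mathcal{V}'$ matrix obtained from $L$ by deleting the row and column of $v_*$. Inequalities between functions on $\mathcal{V}'$ are pointwise, and constants such as $1$ denote constant functions. A sandpile is a non-negative element of $\mathbb{Z}^{\mathcal{V}'}$. Odometers: for $G\in\{\mathbb{Z},\mathbb{R}\}$ and $\sigma\in\mathbb{Z}^{\mathcal{V}'}$, the $G$-odometer $u_\sigma^G\in G^{\mathcal{V}'}$ is the (existing and unique) element satisfying $\sigma-L'u\le d-1$ and $u\ge 0$ which is minimal, i.e. $u_\sigma^G\le u$ for every $u\in G^{\mathcal{V}'}$ satisfying both inequalities. The sandpile $\sigma$ is immutable if $u_\sigma^{\mathbb{Z}}=u_\sigma^{\mathbb{R}}$,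 and mutable otherwise. *)

(* Defs.v *)
From HB Require Import structures.
From mathcomp Require Import all_boot all_order all_algebra.
From mathcomp Require Import boolp classical_sets reals.

Set Implicit Arguments.
Unset Strict Implicit.
Unset Printing Implicit Defensive.

Import Order.TTheory GRing.Theory Num.Theory.
Local Open Scope ring_scope.

(* A finite multigraph without self-loops, given by its edge multiplicities. *)
Record multigraph (V : finType) := Multigraph {
  nedges : V -> V -> nat;
  nedgesC : forall v w, nedges v w = nedges w v;
  nedges_loopless : forall v, nedges v v = 0%N
}.

Notation nonsink s := {v | v != s}.

Section Sandpiles.
Variables (V : finType) (Gamma : multigraph V) (s : V).

Definition adj : rel V := fun v w => (0 < nedges Gamma v w)%N.

Definition connected_graph : Prop := forall v w, connect adj v w.

(* The edge-path visits w :: p; in particular w itself must differ from v. *)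
Definition joined_avoiding (v w t : V) : Prop :=
  exists p : seq V, [/\ path adj w p, last w p = t & v \notin w :: p].

Definition degree (v : V) : nat := (\sum_(w : V) nedges Gamma v w)%N.

Definition laplacian (v w : V) : int :=
  if v == w then (degree v)%:Z else - (nedges Gamma v w)%:Z.

Definition reduced_laplacian (v w : nonsink s) : int :=
  laplacian (val v) (val w).

Definition sandpile (sigma : {ffun nonsink s -> int}) : Prop :=
  forall v, 0 <= sigma v.

Definition stabilizing (G : numDomainType) (sigma : {ffun nonsink s -> int})
    (u : {ffun nonsink s -> G}) : Prop :=
  (forall v, (sigma v)%:~R - \sum_w (reduced_laplacian v w)%:~R * u w
             <= (degree (val v))%:R - 1)
  /\ (forall v, 0 <= u v).

Definition is_odometer (G : numDomainType) (sigma : {ffun nonsink s -> int})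
    (u : {ffun nonsink s -> G}) : Prop :=
  stabilizing sigma u /\
  (forall u' : {ffun nonsink s -> G}, stabilizing sigma u' ->
     forall v, u v <= u' v).

(* When Gamma is connected and G is int or a realType, the odometer exists;
   it is unique by is_odometer_eq below. The default value 0 is irrelevant. *)
Definition odometer (G : numDomainType) (sigma : {ffun nonsink s -> int})
    : {ffun nonsink s -> G} :=
  xget 0 [set u | is_odometer sigma u]%classic.

Lemma is_odometer_eq (G : numDomainType) (sigma : {ffun nonsink s -> int})
    (u : {ffun nonsink s -> G}) :
  is_odometer sigma u -> odometer G sigma = u.
Proof.
move=> u_odo; rewrite /odometer; case: xgetP => [u' _ [st' min']|no_odo].
  case: u_odo => st min; apply/ffunP => v; apply: le_anti.
  by rewrite min' //= min.
by case: (no_odo u).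
Qed.

Definition immutable (R : realType) (sigma : {ffun nonsink s -> int}) : Prop :=
  forall v, (odometer int sigma v)%:~R = odometer R sigma v.

Definition mutable (R : realType) (sigma : {ffun nonsink s -> int}) : Prop :=
  ~ immutable R sigma.

End Sandpiles.

(* Main.v *)
Require Import Defs.
From mathcomp Require Import all_boot all_order all_algebra.
From mathcomp Require Import reals ring lra.

(** For x a non-sink vertex, let g be the Green function at x: the real function
with g = 0 at the sink s and L' g equal to the indicator e of x.  For the
sandpile sigma = d - 1 + e, the function g satisfies sigma - L' g = d - 1
exactly, and it is nonnegative; any other real u stabilizing sigma has
L' (u - g) >= 0, hence u >= g by the minimum principle for L'.  So g is the real
odometer of sigma (lemma [green_odometer]), and sigma is mutable as soon as g
is not integer valued.

Take x = v.  Off v and s the function g is harmonic, so a maximum of g attained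
at some w <> v propagates along a path from w to s avoiding v, which would force
max g = g s = 0.  Since (L g) v = 1, this is impossible: under hypothesis (a),
g has a strict maximum at v ([green_strict_max]).  But the equation at v reads

  1 = sum over the edges joining v to a vertex w of (g v - g w),

a sum of d(v) >= 2 positive numbers.  If g were integer valued, each of them
would be at least 1. *)

Set Implicit Arguments.
Unset Strict Implicit.
Unset Printing Implicit Defensive.

Import Order.TTheory GRing.Theory Num.Theory.
Local Open Scope ring_scope.

(** * Square linear systems indexed by a finite type *)

Lemma injective_system_solvable (K : fieldType) (T : finType)
    (a : T -> T -> K) :
  (forall u : T -> K, (forall x, \sum_y a x y * u y = 0) -> forall y, u y = 0) ->
  forall b : T -> K, exists u : T -> K, forall x, \sum_y a x y * u y = b x.
Proof.
move=> a_inj b.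
pose A := \matrix_(i < #|T|, j < #|T|) a (enum_val j) (enum_val i).
have AE (r : 'rV[K]_#|T|) x :
    \sum_y a x y * r 0 (enum_rank y) = (r *m A) 0 (enum_rank x).
  rewrite mxE (big_enum_val (A := T)); apply: eq_bigr => i _.
  by rewrite mxE enum_rankK enum_valK mulrC.
have A_unit : A \in unitmx.
  rewrite -row_free_unit; apply: inj_row_free => r rA0.
  apply/rowP => i; rewrite mxE -[i]enum_valK.
  by apply: (a_inj (fun y => r 0 (enum_rank y))) => x; rewrite AE rA0 mxE.
exists (fun y => (\row_i b (enum_val i) *m invmx A) 0 (enum_rank y)) => x.
by rewrite AE mulmxKV // mxE enum_rankK.
Qed.

(** * Minimum principle for the graph Laplacian *)

Section Laplacian.
Variables (V : finType) (Gamma : multigraph V).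
Implicit Types (K : realFieldType) (x y v s t w : V).

(** The action of the Laplacian matrix in divergence form, where the sign of
each summand is visible; it is linked to the matrix by [reduced_laplacianE]. *)
Definition laplace K (f : V -> K) x : K :=
  \sum_y (nedges Gamma x y)%:R * (f x - f y).

Lemma laplaceB K (f h : V -> K) x :
  laplace (fun y => f y - h y) x = laplace f x - laplace h x.
Proof. by rewrite -sumrB; apply: eq_bigr => y _; ring. Qed.

Lemma laplaceN K (f : V -> K) x : laplace (fun y => - f y) x = - laplace f x.
Proof. by rewrite -sumrN; apply: eq_bigr => y _; ring. Qed.

(** A sum of nonpositive terms is nonnegative only if every term vanishes. *)
Lemma min_neighbour K (f : V -> K) x y :
  (forall z, f x <= f z) -> 0 <= laplace f x -> adj Gamma x y -> f y = f x.
Proof.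
move=> x_min lap_ge0 xy.
have term_ge0 z : true -> 0 <= (nedges Gamma x z)%:R * (f z - f x).
  by move=> _; rewrite mulr_ge0 ?ler0n ?subr_ge0.
have sum0 : \sum_z (nedges Gamma x z)%:R * (f z - f x) = 0.
  apply/eqP; rewrite eq_le sumr_ge0 // andbT -oppr_ge0 -sumrN.
  by under eq_bigr => z _ do rewrite -mulrN opprB.
have /(_ y isT)/eqP := psumr_eq0P term_ge0 sum0.
by rewrite mulf_eq0 pnatr_eq0 eqn0Ngt [(0 < _)%N]xy /= subr_eq0 => /eqP.
Qed.

(** Superharmonicity is asked only at the vertices of the path other than its
end t, so that the path may be chosen to dodge a vertex where it fails. *)
Lemma min_on_path K (f : V -> K) t w (p : seq V) :
    path (adj Gamma) w p -> last w p = t -> (forall y, f w <= f y) ->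
    {in w :: p, forall x, x != t -> 0 <= laplace f x} ->
  f t = f w.
Proof.
elim: p w => [|x p IHp] w /=; first by move=> _ ->.
move=> /andP[wx xp] pt w_min super.
have [<- //|wNt] := eqVneq w t.
have xw : f x = f w.
  by apply: min_neighbour wx => //; apply: super; rewrite ?mem_head.
rewrite -xw; apply: IHp => // [y|y yp]; first by rewrite xw.
by apply: super; rewrite inE yp orbT.
Qed.

(** A vertex where f is minimal is joined to s by a path, along which the
minimum spreads; hence min f = f s = 0. *)
Lemma laplace_min_principle K s (f : V -> K) :
    connected_graph Gamma -> f s = 0 ->
    (forall x, x != s -> 0 <= laplace f x) ->
  forall x, 0 <= f x.
Proof.
move=> conn fs0 super x.
case: (@arg_minP _ _ _ s xpredT f) => // w _ w_min.
have /connectP[p wp sp] := conn w s.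
rewrite -fs0 (min_on_path wp (esym sp)) => [|y|y _]; [exact: w_min..|].
exact: super.
Qed.

(** * Green functions at a vertex that does not separate the graph from the sink *)

(** A maximum of g at w <> v spreads along a path from w to s avoiding v, so
that g <= g s = 0.  With g >= 0 this makes g vanish identically, against
(L g) v > 0. *)
Lemma green_strict_max K s v (g : V -> K) :
    (forall w, w != v -> joined_avoiding Gamma v w s) -> g s = 0 ->
    (forall x, 0 <= g x) -> 0 < laplace g v ->
    (forall x, x != s -> x != v -> laplace g x = 0) ->
  forall w, w != v -> g w < g v.
Proof.
move=> avoid gs0 g_ge0 lapv_gt0 harm.
suff max_is_v w : (forall y, g y <= g w) -> w = v.
  case: (@arg_maxP _ _ _ s xpredT g) => // m _ m_max w wNv.
  have g_le_m y : g y <= g m by exact: m_max.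
  rewrite -(max_is_v m) // lt_neqAle g_le_m andbT.
  by apply: contra_neq wNv => gwm; apply: max_is_v => y; rewrite gwm.
move=> w_max; apply/eqP; apply: contraTT lapv_gt0 => wNv.
have [p [wp ps vNp]] := avoid w wNv.
have gw0 : g w = 0.
  rewrite -[g w]opprK -gs0 -[g s in RHS]opprK; congr (- _); symmetry.
  apply: (min_on_path (f := fun y => - g y)) wp ps _ _ => [y|x xp xNs].
    by rewrite lerN2.
  rewrite laplaceN harm ?oppr0 //.
  by apply: contraNneq vNp => <-.
rewrite -leNgt; apply: sumr_le0 => y _.
have g0 z : g z = 0 by apply/le_anti; rewrite g_ge0 andbT -gw0.
by rewrite !g0 subr0 mulr0.
Qed.

(** Each of the d(v) edges at v contributes at least 1 to (L g) v. *)
Lemma degree_le_laplace K v (g : V -> K) :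
    (forall x, exists m : int, g x = m%:~R) ->
    (forall w, w != v -> g w < g v) ->
  (degree Gamma v)%:R <= laplace g v.
Proof.
move=> g_int v_max; rewrite natr_sum; apply: ler_sum => w _.
have [->|wNv] := eqVneq w v; first by rewrite nedges_loopless mul0r.
rewrite ler_peMr ?ler0n // lerBrDl addrC.
have [[m gvE] [n gwE]] := (g_int v, g_int w).
by have := v_max w wNv; rewrite gvE gwE ltr_int -lezD1 -(ler_int K) rmorphD /= addrC.
Qed.

(** * The odometer as a Green function *)

Lemma degree_gt0 s v : connected_graph Gamma -> v != s -> (0 < degree Gamma v)%N.
Proof.
move=> conn vNs; case/connectP: (conn v s) => -[|w p] /=.
  by move=> _ vs; rewrite vs eqxx in vNs.
case/andP=> vw _ _; apply: leq_trans vw _.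
by rewrite /degree (bigD1 w) //= leq_addr.
Qed.

Section Sink.
Variable s : V.
Implicit Types a b : nonsink s.

(** Functions on the non-sink vertices are continued by 0 at the sink, which
turns the reduced Laplacian into the full one. *)
Definition extend K (u : nonsink s -> K) x : K := oapp u 0 (insub x).

Lemma extend_val K (u : nonsink s -> K) a : extend u (val a) = u a.
Proof. by rewrite /extend valK. Qed.

Lemma extend_sink K (u : nonsink s -> K) : extend u s = 0.
Proof. by rewrite /extend insubF ?eqxx. Qed.

Lemma reduced_laplacianE K (u : nonsink s -> K) a :
  \sum_b (reduced_laplacian Gamma a b)%:~R * u b = laplace (extend u) (val a).
Proof.
under eq_bigr => b _ do rewrite -extend_val.
rewrite -(big_sub [pred x | x != s]
  (fun x => (laplacian Gamma (val a) x)%:~R * extend u x)) /=.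
have -> : \sum_(x | x != s) (laplacian Gamma (val a) x)%:~R * extend u x =
    \sum_x (laplacian Gamma (val a) x)%:~R * extend u x.
  by rewrite [RHS](bigD1 s) //= extend_sink mulr0 add0r.
rewrite /laplace; under [RHS]eq_bigr => x _ do rewrite mulrBr.
rewrite sumrB -mulr_suml -natr_sum.
rewrite (bigD1 (val a)) //= [X in _ = _ - X](bigD1 (val a)) //=.
rewrite nedges_loopless mul0r add0r /laplacian eqxx -sumrN; congr (_ + _).
by apply: eq_bigr => x; rewrite eq_sym => /negPf->; rewrite rmorphN /= mulNr.
Qed.

(** The reduced Laplacian is injective, by the minimum principle applied to an
element of its kernel and to its opposite; being square, it is surjective. *)
Lemma reduced_laplacian_solvable K (b : nonsink s -> K) :
    connected_graph Gamma ->
  exists g : nonsink s -> K, forall a, laplace (extend g) (val a) = b a.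
Proof.
move=> conn.
have [|g gE] := @injective_system_solvable K (nonsink s)
    (fun a a' => (reduced_laplacian Gamma a a')%:~R) _ b; last first.
  by exists g => a; rewrite -reduced_laplacianE.
move=> u u_ker c.
have lap0 x : x != s -> laplace (extend u) x = 0.
  by move=> xNs; rewrite -[x]/(val (exist _ x xNs : nonsink s)) -reduced_laplacianE.
rewrite -extend_val; apply/le_anti; rewrite -oppr_ge0.
rewrite (@laplace_min_principle K s (fun x => - extend u x)) //=.
- apply: (@laplace_min_principle K s) => // [|x xNs]; first exact: extend_sink.
  by rewrite lap0.
- by rewrite extend_sink oppr0.
- by move=> x xNs; rewrite laplaceN lap0 ?oppr0.
Qed.

(** One chip more at v than the maximal stable configuration d - 1: removing the
excess exactly takes the Green function at v as real firing vector. *)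
Definition green_sandpile (v : V) : {ffun nonsink s -> int} :=
  [ffun a => (degree Gamma (val a))%:Z - 1 + (val a == v)%:R].

Lemma green_sandpileP v : connected_graph Gamma -> sandpile (green_sandpile v).
Proof.
move=> conn a; rewrite ffunE addr_ge0 ?ler0n // subr_ge0.
by rewrite (lez_nat 1) (degree_gt0 conn (valP a)).
Qed.

(** The odometer is the Green function because the constraint
sigma - L' u <= d - 1 reads L' u >= L' g, and L' has a monotone inverse. *)
Lemma green_odometer (R : realType) v :
    connected_graph Gamma ->
    (forall a, laplace (extend (odometer Gamma R (green_sandpile v))) (val a)
       = (val a == v)%:R)
  /\ (forall a, 0 <= odometer Gamma R (green_sandpile v) a).
Proof.
move=> conn.
have [g0 g0E] := @reduced_laplacian_solvable R (fun a => (val a == v)%:R) conn.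
pose g : {ffun nonsink s -> R} := finfun g0.
have extgE x : extend g x = extend g0 x.
  by rewrite /extend; case: insub => //= a; rewrite ffunE.
have gE a : laplace (extend g) (val a) = (val a == v)%:R.
  by rewrite -g0E; apply: eq_bigr => y _; rewrite !extgE.
have stabE (u : {ffun nonsink s -> R}) a :
    (green_sandpile v a)%:~R
      - \sum_b (reduced_laplacian Gamma a b)%:~R * u b
      <= (degree Gamma (val a))%:R - 1
    <-> laplace (extend g) (val a) <= laplace (extend u) (val a).
  rewrite reduced_laplacianE gE ffunE rmorphD rmorphB /= rmorph_nat.
  by split; lra.
have g_ge0 a : 0 <= g a.
  rewrite -extend_val; apply: (@laplace_min_principle R s) => //.
    exact: extend_sink.
  move=> x xNs; rewrite -[x]/(val (exist _ x xNs : nonsink s)) gE; exact: ler0n.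
rewrite (@is_odometer_eq _ _ _ _ _ g) //; split.
  by split=> // a; apply/stabE.
move=> u [u_stab u_ge0] a; rewrite -subr_ge0 -!(extend_val _ a).
apply: (@laplace_min_principle R s (fun x => extend u x - extend g x)) => //.
  by rewrite !extend_sink subr0.
move=> x xNs; rewrite laplaceB subr_ge0 -[x]/(val (exist _ x xNs : nonsink s)).
exact/stabE.
Qed.

End Sink.
End Laplacian.

(** * Existence of a mutable sandpile *)

Theorem corollary1p2 (R : realType) (V : finType) (Gamma : multigraph V)
    (s : V) (hconn : connected_graph Gamma) (hV : (2 <= #|V|)%N)
    (hv : exists v : V,
       [/\ v != s, adj Gamma v s,
           (forall w : V, w != v -> joined_avoiding Gamma v w s)
         & (2 <= degree Gamma v)%N]) :
  exists sigma : {ffun nonsink s -> int},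
    sandpile sigma /\ mutable Gamma R sigma.
Proof.
have [v [vNs _ avoid deg_v]] := hv.
exists (green_sandpile Gamma s v); split; first exact: green_sandpileP.
move=> immut; have [] := @green_odometer _ _ s R v hconn.
set g := odometer Gamma R _ => gE g_ge0.
have lapE x : x != s -> laplace Gamma (extend g) x = (x == v)%:R.
  by move=> xNs; rewrite -[x]/(val (exist _ x xNs : nonsink s)) gE.
have g_int x : exists m : int, extend g x = m%:~R.
  have [->|xNs] := eqVneq x s; first by exists 0; rewrite extend_sink.
  rewrite -[x]/(val (exist _ x xNs : nonsink s)) extend_val -immut.
  by eexists.
have g_max : forall w, w != v -> extend g w < extend g v.
  apply: (green_strict_max avoid); first exact: extend_sink.
  - by move=> x; rewrite /extend; case: insub => //= a; exact: g_ge0.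
  - by rewrite lapE // eqxx ltr01.
  - by move=> x xNs /negPf xNv; rewrite lapE // xNv.
have := degree_le_laplace Gamma g_int g_max.
by rewrite lapE // eqxx ler_nat leqNgt deg_v.
Qed.
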